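(* Let $G$ be a group, $X$ a $\mathbf 0$-distributive bounded $G$-lattice, and $A=\{a_0,\dots,a_{n-1}\}\subset X\setminus\{\mathbf 0\}$ a finite subset. Let $\hbar$ be the cardinal-valued function on $n=\{0,\dots,n-1\}$ defined by $\hbar(i)=\operatorname{lar}(\Delta(a_i))$. If $\bigvee_{i\in n}a_i=\mathbf 1$, then $\hbar$ is not $0$-generating.
   Context: A lattice is a set $X$ with commutative, associative, idempotent operations $\vee,\wedge$ satisfying the absorption laws, ordered by $x\le y$ iff $x\wedge y=x$; bounded means there are least and greatest elements $\mathbf 0\ne\mathbf 1$; $\mathbf 0$-distributive means $x\wedge(y\vee z)=(x\wedge y)\vee(x\wedge z)$ whenever $x\wedge y=\mathbf 0$. A $G$-lattice is a lattice with an action of $G$ by lattice automorphisms. $\Delta(a)=\{g\in G:ga\wedge a\ne\mathbf 0\}$; for nonempty $D\subset G$, $\operatorname{lar}(D)=\min\{|F|:F\subset G,\ G=FD\}$ (a cardinal). Identify $n$ with $\{0,\dots,n-1\}$; $\omega^n$ is the set of functions $n\to\omega=\{0,1,2,\dots\}$ with pointwise addition; $1_i\in\omega^n$ takes value $1$ at $i$ and $0$ elsewhere. For a cardinal-valued $\hbar$ on $n$, ${\downarrow}\hbar=\{g\in\omega^n:g(i)<\hbar(i)\ \forall i\}$. For $A_0,\dots,A_{n-1}\subset\omega^n$, $\sum_{i\in n}A_i=\{\sum_i a_i: a_i\in A_i\}$. Define $\hbar^{[0]}(i)=\hbar^{\{0\}}(i)=\{1_i\}$, $\hbar^{\{m+1\}}(i)=\{x-x(i)1_i: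 x\in({\downarrow}\hbar)\cap\sum_{j\in n}\hbar^{[m]}(j)\}$, $\hbar^{[m+1]}(i)=\hbar^{\{m+1\}}(i)\cup\hbar^{[m]}(i)$, and $\hbar^{[\omega]}(i)=\bigcup_{m\in\omega}\hbar^{\{m\}}(i)$. $\hbar$ is $0$-generating if the constant zero function belongs to $\bigcup_{i\in n}\hbar^{[\omega]}(i)$. *)

(* Defs.v *)
From HB Require Import structures.
From mathcomp Require Import all_boot all_order all_algebra.
From mathcomp Require Import boolp classical_sets functions cardinality.
Set Implicit Arguments.
Unset Strict Implicit.
Unset Printing Implicit Defensive.
Import Order.TTheory GRing.Theory.
Local Open Scope classical_set_scope.
Local Open Scope card_scope.

(* Cardinals are represented by sets, compared only through [#<=] and [#=]
   (so always up to equipotence). *)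
Definition card_lt T U (A : set T) (B : set U) : Prop :=
  A #<= B /\ ~ (B #<= A).

Definition has_min_card T (C : set (set T)) (A : set T) : Prop :=
  C A /\ forall B, C B -> A #<= B.

(* Cardinals are well-ordered: Zorn's lemma gives a maximal set S of choice
   functions on which all evaluation maps are injective; by maximality one of
   them maps S onto a member of C. *)
Lemma ex_min_card T (C : set (set T)) :
  C !=set0 -> exists A, has_min_card C A.
Proof.
move=> [A0 CA0].
have [[B CB B0]|/forall2NP neC] :=
    pselect (exists2 B, C B & B = set0).
  by exists B; split=> // A' _; rewrite B0 card_ge0.
have [t0 _] : A0 !=set0.
  by apply/set0P/eqP; case: (neC A0).
pose P (S : set (set T -> T)) :=
  (forall f, S f -> forall F, C F -> F (f F)) /\
  (forall f g, S f -> S g -> forall F, C F -> f F = g F -> f = g).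
have [|S [[PS1 PS2] maxS]] := @Zorn_bigcup _ P.
  move=> F FP totF; split.
    by move=> f [S FS Sf]; have [+ _] := FP _ FS; apply.
  move=> f g [S FS Sf] [S' FS' S'g] E CE fg.
  have [SS'|S'S] := totF _ _ FS FS'.
    by have [_ /(_ f g (SS' _ Sf) S'g E CE fg)] := FP _ FS'.
  by have [_ /(_ f g Sf (S'S _ S'g) E CE fg)] := FP _ FS.
have [A CA Asurj] :
    exists2 A, C A & forall y, A y -> exists2 f, S f & f A = y.
  apply: contrapT => /forall2NP noA.
  have /choice[h hP] F :
      exists y, C F -> F y /\ (forall f, S f -> f F <> y).
    have [CF|nCF] := pselect (C F); last by exists t0.
    have [//|/existsNP[y /not_implyP[Fy /forall2NP yP]]] := noA F.
    by exists y => _; split=> // f Sf fy; have [] := yP f.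
  apply: (maxS (S `|` [set h])); last split.
  - split=> [f Sf|Sh]; first by left.
    have [_ /(_ h (Sh _ (or_intror erefl)))] := hP _ CA0.
    exact.
  - by move=> f [/PS1 //|-> F /hP[]].
  - move=> f g [Sf|->] [Sg|->] // F CF.
    + exact: (PS2 f g).
    + by move=> /(proj2 (hP F CF) f Sf).
    + by move=> /esym /(proj2 (hP F CF) g Sg).
exists A; split=> // B CB.
apply: (@card_le_trans _ _ _ S).
  rewrite (@card_le_trans _ _ _ ((fun f => f A) @` S))// ?card_image_le//.
  by apply: subset_card_le => y /Asurj[f Sf <-]; exists f.
have injB : {in S &, injective (fun f : set T -> T => f B)}.
  by move=> f g /set_mem Sf /set_mem Sg; exact: PS2.
have /card_eqPle[_ +] : (fun f : set T -> T => f B) @` S #= S.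
  exact: inj_card_eq.
move=> /card_le_trans; apply.
by apply: subset_card_le => _ [f Sf <-]; exact: (PS1 f Sf B CB).
Qed.

Definition setmul (G : groupType) (F D : set G) : set G :=
  [set (f * x)%g | f in F & x in D].

(* lar D is some F with G = FD of least cardinality: a representative of the
   cardinal min {|F| : F `<=` G, G = FD}. *)
Definition lar (G : groupType) (D : set G) : set G :=
  xget [set: G] (has_min_card [set F | [set: G] = setmul F D]).

Lemma larP (G : groupType) (D : set G) : D !=set0 ->
  has_min_card [set F | [set: G] = setmul F D] (lar D).
Proof.
move=> [x Dx]; apply: xgetPex; apply: ex_min_card; exists setT => /=.
apply/esym/seteqP; split=> // g _.
by exists (g / x)%g => //; exists x => //; rewrite mulgVK.
Qed.

(* Bijectivity of each act g follows from act1 and actM. *)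
Record lattice_action (G : groupType) d (X : latticeType d)
    (act : G -> X -> X) : Prop := LatticeAction {
  act1 : forall x, act 1%g x = x;
  actM : forall g h x, act (g * h)%g x = act g (act h x);
  actI : forall g x y, act g (x `&` y)%O = (act g x `&` act g y)%O;
  actU : forall g x y, act g (x `|` y)%O = (act g x `|` act g y)%O
}.

Definition zero_distributive d (X : bLatticeType d) : Prop :=
  forall x y z : X, (x `&` y)%O = \bot%O ->
    (x `&` (y `|` z))%O = ((x `&` y) `|` (x `&` z))%O.

Definition Delta (G : groupType) d (X : bLatticeType d) (act : G -> X -> X)
    (a : X) : set G :=
  [set g | (act g a `&` a)%O <> \bot%O].

Section ZeroGenerating.
Variable n : nat.
Local Notation omegan := {ffun 'I_n -> nat}.

Definition unit_fun (i : 'I_n) : omegan := [ffun j => nat_of_bool (j == i)].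

(* The function x - x(i) 1_i, with value 0 at i and x(j) at j <> i; the
   truncated subtraction is exact here. *)
Definition clear_at (i : 'I_n) (x : omegan) : omegan :=
  [ffun j => x j - x i * unit_fun i j].

Definition sumset (B : 'I_n -> set omegan) : set omegan :=
  [set x | exists2 b : 'I_n -> omegan,
    forall i, B i (b i) & x = (\sum_(i < n) b i)%R].

(* h is a cardinal-valued function on n. *)
Variables (T : Type) (h : 'I_n -> set T).

Definition down : set omegan := [set g | forall i, card_lt `I_(g i) (h i)].

Definition gen_step (B : 'I_n -> set omegan) (i : 'I_n) : set omegan :=
  [set clear_at i x | x in down `&` sumset B].

(* hsquare m, hcurly m and homega stand for h^[m], h^{m} and h^[omega]. *)
Fixpoint hsquare (m : nat) (i : 'I_n) : set omegan :=
  if m is m'.+1 then gen_step (hsquare m') i `|` hsquare m' i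
  else [set unit_fun i].

Definition hcurly (m : nat) (i : 'I_n) : set omegan :=
  if m is m'.+1 then gen_step (hsquare m') i else [set unit_fun i].

Definition homega (i : 'I_n) : set omegan := \bigcup_m hcurly m i.

Definition zero_generating : Prop :=
  (\bigcup_i homega i) (0%R : omegan).

End ZeroGenerating.

(* Main.v *)
Require Import Defs.
From HB Require Import structures.
From mathcomp Require Import all_boot all_order all_algebra.
From mathcomp Require Import boolp classical_sets functions cardinality.

(** By induction on the stage, every [x] in [h^[m](i)] yields a cover of [a_i]
by [x(k)] translates of each [a_k]; for [x = 0] this forces [a_i] to be [0].
In the inductive step, summing covers of all the [a_j] gives a cover of [1] by
translates of the [a_k] with multiplicities [x(k)].  If [x(i) < lar(Delta(a_i))],
some [g a_i] is disjoint from each of the [x(i)] translates of [a_i] used, hence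
by 0-distributivity it lies below the join of the remaining translates; applying
[g^-1] gives a cover of [a_i] with multiplicities [x - x(i) 1_i]. *)

Import Order.TTheory.
Local Open Scope classical_set_scope.
Local Open Scope card_scope.

Section ZeroDistributive.
Context {d : Order.disp_t} {X : bLatticeType d}.
Hypothesis X_distr : zero_distributive X.
Local Open Scope order_scope.

(** By [X_distr], the elements disjoint from [x] are closed under binary joins, so induction along
    the finite join applies. *)
Lemma meetx_join_eq0 (I : Type) (r : seq I) (P : pred I) (x : X) (F : I -> X) :
  (forall i, P i -> x `&` F i = \bot) ->
  x `&` \join_(i <- r | P i) F i = \bot.
Proof.
move=> xF; apply: (big_ind (fun y => x `&` y = \bot)) => //; first exact: meetx0.
by move=> y z xy xz; rewrite X_distr // xy xz joinx0.
Qed.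

Lemma le_join_disjoint {x y z : X} :
  x `&` y = \bot -> x <= y `|` z -> x <= z.
Proof.
move=> xy /meet_idPl; rewrite X_distr // xy join0x => <-; exact: leIr.
Qed.

End ZeroDistributive.

Section LatticeAction.
Context {G : groupType} {d : Order.disp_t}.
Local Open Scope order_scope.

Lemma act_le {X : latticeType d} {act : G -> X -> X} (g : G) {x y : X} :
  lattice_action act -> x <= y -> act g x <= act g y.
Proof. by move=> L /meet_idPl xy; rewrite leEmeet -(actI L) xy. Qed.

Lemma actK {X : latticeType d} {act : G -> X -> X} (g : G) (x : X) :
  lattice_action act -> act g^-1%g (act g x) = x.
Proof. by move=> L; rewrite -(actM L) mulVg (act1 L). Qed.

Lemma act_bot {X : bLatticeType d} {act : G -> X -> X} (g : G) :
  lattice_action act -> act g \bot = \bot.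
Proof.
(* The right-hand [\bot] is rewritten as the image under [g] of [act g^-1 \bot], which lies above
   [act g \bot] by monotonicity. *)
move=> L; apply/eqP; rewrite -lex0 -{2}(actK g^-1%g \bot L) invgK.
by apply: act_le => //; exact: le0x.
Qed.

Lemma act_join {X : bLatticeType d} {act : G -> X -> X} (g : G)
    (I : Type) (r : seq I) (P : pred I) (F : I -> X) :
  lattice_action act ->
  act g (\join_(i <- r | P i) F i) = \join_(i <- r | P i) act g (F i).
Proof.
by move=> L; apply: big_morph; [exact: (actU L)|exact: act_bot].
Qed.

(** Nonemptiness of [Delta act a] makes its [lar] a genuine minimum, not the default of [xget]. *)
Lemma Delta1 {X : bLatticeType d} {act : G -> X -> X} (a : X) :
  lattice_action act -> a <> \bot -> Delta act a 1%g.
Proof. by move=> L a0; rewrite /Delta /= (act1 L) meetxx. Qed.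

End LatticeAction.

Lemma card_le_set_seq {T : eqType} (s : seq T) : [set` s] #<= `I_(size s).
Proof.
(* A nonempty list supplies the default [t] for [nth], which maps the indices onto the entries;
   repeated entries leave only an inequality. *)
case E: s => [|t s']; first by rewrite set_nil card_ge0.
rewrite -E; apply: card_le_trans _ (card_image_le (nth t s) _).
apply: subset_card_le => y ys; exists (index y s); last exact: nth_index.
by rewrite /mkset index_mem.
Qed.

(** If every translate of [a] met some [act f a] with [f] in [s], then the entries of [s] times
    [Delta act a] would exhaust [G], forcing [lar] to be at most [size s]. *)
Lemma card_lt_lar_disjoint {G : groupType} {d} {X : bLatticeType d}
    {act : G -> X -> X} {a : X} {s : seq G} :
  lattice_action act -> a <> \bot%O ->
  card_lt `I_(size s) (lar (Delta act a)) ->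
  exists g, forall f, f \in s -> (act g a `&` act f a)%O = \bot%O.
Proof.
move=> L a0 [_ nle]; apply: contrapT => /forallNP noG; apply: nle.
have [_ lar_min] := larP (D := Delta act a) (ex_intro _ _ (Delta1 a L a0)).
apply: card_le_trans (lar_min [set` s] _) (card_le_set_seq s).
apply/esym/seteqP; split=> // g _.
have /existsNP[f /not_implyP[fs gf]] := noG g.
(* Applying [f] to the meet of [act (f^-1 * g) a] and [a] gives the meet of [act g a] and
   [act f a]. *)
exists f => //; exists (f^-1 * g)%g; last by rewrite mulgA mulgV mul1g.
move=> /(congr1 (act f)).
by rewrite (actI L) -(actM L) mulgA mulgV mul1g act_bot.
Qed.

Section Translates.
Context {G : groupType} {d : Order.disp_t} {X : tbLatticeType d}.
Context {act : G -> X -> X} {n : nat}.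
Variable a : 'I_n -> X.
Hypothesis act_lattice : lattice_action act.
Local Open Scope order_scope.

Definition join_translates (s : 'I_n -> seq G) : X :=
  \join_(k < n) \join_(g <- s k) act g (a k).

(** Lists rather than sets of group elements: repetitions are allowed, so sizes can equal [x k]
    exactly and add up under concatenation. *)
Definition covered_by_translates (y : X) (x : {ffun 'I_n -> nat}) : Prop :=
  exists2 s : 'I_n -> seq G,
    forall k, size (s k) = x k & y <= join_translates s.

Lemma covered_unit_fun i : covered_by_translates (a i) (unit_fun i).
Proof.
exists (fun k => if k == i then [:: 1%g] else [::]) => [k|].
  by rewrite ffunE; case: (k == i).
rewrite /join_translates; apply: (joins_min (j := i)) => //.
by rewrite eqxx big_seq1 (act1 act_lattice).
Qed.

Lemma covered0 y : covered_by_translates y 0%R -> y = \bot.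
Proof.
move=> [s s0]; rewrite /join_translates big1 ?lex0 => [/eqP //|k _].
have /size0nil -> : size (s k) = 0%N by rewrite s0 ffunE.
by rewrite big_nil.
Qed.

(** For each [k], the lists used in covering the different [a j] are concatenated. *)
Lemma covered_sum (b : 'I_n -> {ffun 'I_n -> nat}) :
  (forall j, covered_by_translates (a j) (b j)) ->
  covered_by_translates (\join_(j < n) a j) (\sum_(j < n) b j)%R.
Proof.
move=> cov.
have /choice[s sP] j : exists s : 'I_n -> seq G,
    (forall k, size (s k) = b j k) /\ a j <= join_translates s.
  by have [s] := cov j; exists s.
exists (fun k => flatten [seq s j k | j <- enum 'I_n]) => [k|].
  rewrite size_flatten /shape -map_comp sumnE big_map big_enum /= sum_ffunE.
  by apply: eq_bigr => j _; rewrite (sP j).1.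
apply/joinsP => j _; apply: le_trans (sP j).2 _.
apply/joinsP => k _; apply: (joins_min (j := k)) => //.
rewrite big_flatten big_map big_enum.
exact: (joins_min (j := j)).
Qed.

Lemma covered_clear_at i (x : {ffun 'I_n -> nat}) :
  zero_distributive X -> a i <> \bot ->
  card_lt `I_(x i) (lar (Delta act (a i))) ->
  covered_by_translates \top x -> covered_by_translates (a i) (clear_at i x).
Proof.
move=> X_distr ai0 + [s sx top_le]; rewrite -sx.
move=> /(card_lt_lar_disjoint act_lattice ai0)[g gP].
(* The translates of [a i] are dropped and the others are moved by [g^-1], where [act g (a i)]
   avoids every dropped translate. *)
exists (fun k => if k == i then [::] else [seq (g^-1 * f)%g | f <- s k])
    => [k|].
  rewrite !ffunE; case: eqVneq => [->|_].
    by rewrite muln1 subnn.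
  by rewrite size_map sx muln0 subn0.
rewrite -(actK g (a i) act_lattice).
have gai_le : act g (a i) <= \join_(k < n | k != i) \join_(f <- s k) act f (a k).
  have disj : act g (a i) `&` \join_(f <- s i) act f (a i) = \bot.
    by rewrite big_seq; apply: meetx_join_eq0.
  apply: (le_join_disjoint X_distr disj).
  (* Splitting off the index [i] from the cover of [\top] isolates exactly the part disjoint from
     [act g (a i)]. *)
  by apply: le_trans (lex1 _) (le_trans top_le _); rewrite /join_translates (bigD1 i).
apply: le_trans (act_le g^-1%g act_lattice gai_le) _.
rewrite act_join // /join_translates; apply/joinsP => k ki.
apply: (joins_min (j := k)) => //; rewrite (negbTE ki) big_map act_join //.
by under [leRHS]eq_bigr do rewrite (actM act_lattice).
Qed.

Lemma covered_hsquare :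
  zero_distributive X -> (forall i, a i <> \bot) -> \join_(i < n) a i = \top ->
  forall m i x, hsquare (fun i => lar (Delta act (a i))) m i x ->
  covered_by_translates (a i) x.
Proof.
move=> X_distr a0 aT; elim=> [|m IH] i x /=.
  by move=> ->; exact: covered_unit_fun.
case; last exact: IH.
move=> [y [y_down [b bP yE]] <-]; apply: covered_clear_at => //.
(* Since the [a j] join to [\top], the sum of their multiplicities covers [\top]. *)
by rewrite -aT yE; apply: covered_sum => j; apply: IH.
Qed.

End Translates.

Lemma hcurly_hsquare n T (h : 'I_n -> set T) m i :
  hcurly h m i `<=` hsquare h m i.
Proof. by case: m => //= m; exact: subsetUl. Qed.

Theorem theorem1p14 (G : groupType) (d : Order.disp_t) (X : tbLatticeType d)
    (act : G -> X -> X) (n : nat) (a : 'I_n -> X)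
    (X_nontrivial : (\bot : X)%O <> (\top : X)%O)
    (act_lattice : lattice_action act)
    (X_distr : zero_distributive X)
    (a_neq0 : forall i, a i <> \bot%O)
    (a_join : (\join_(i < n) a i)%O = \top%O) :
  ~ zero_generating (fun i => lar (Delta act (a i))).
Proof.
move=> [i _ [m _ /hcurly_hsquare]].
move=> /(covered_hsquare a act_lattice X_distr a_neq0 a_join) /covered0.
exact: a_neq0.
Qed.
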